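(* Let $p>3$ be a prime and let $m$ be an integer with $0<m<p-1$. Then \[ \sum_{k=1}^{p-1}k^mH_k\equiv B_m-\frac{p}{m+1}S(m)\pmod{p^2}, \] where $S(m)=\sum_{r=0}^{m}\binom{m+1}{r}B_rB_{m-r}$.
   Context: $H_n=\sum_{i=1}^n 1/i$ are the harmonic numbers. $B_0,B_1,B_2,\dots$ are the Bernoulli numbers defined by $B_0=1$ and $\sum_{k=0}^n\binom{n+1}{k}B_k=0$ for $n\ge1$ (so $B_1=-1/2$). For rationals $a,b$ whose denominators are coprime to $p$, $a\equiv b\pmod{p^e}$ means that $a-b$, written in lowest terms, has numerator divisible by $p^e$. *)

(* Defs.v *)
From mathcomp Require Import all_boot all_order all_algebra.
Set Implicit Arguments.
Unset Strict Implicit.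
Unset Printing Implicit Defensive.
Import GRing.Theory Num.Theory.
Local Open Scope ring_scope.

Definition harmonic (n : nat) : rat := \sum_(1 <= i < n.+1) i%:R^-1.

(* [:: B_0; ...; B_n]: each new term is obtained by solving
   \sum_(0 <= k < n.+1) 'C(n.+1, k) B_k = 0 for B_n. *)
Fixpoint bernoulli_seq (n : nat) : seq rat :=
  if n is n'.+1 then
    let s := bernoulli_seq n' in
    rcons s (- (\sum_(0 <= k < n) 'C(n.+1, k)%:R * s`_k) / n.+1%:R)
  else [:: 1].

Definition bernoulli (n : nat) : rat := (bernoulli_seq n)`_n.

Lemma size_bernoulli_seq n : size (bernoulli_seq n) = n.+1.
Proof. by elim: n => //= n IHn; rewrite size_rcons IHn. Qed.

Lemma nth_bernoulli_seq n k : (k <= n)%N -> (bernoulli_seq n)`_k = bernoulli k.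
Proof.
elim: n => [|n IHn]; first by rewrite leqn0 => /eqP->.
rewrite leq_eqVlt => /predU1P[-> //|lt_kn].
by rewrite /= nth_rcons size_bernoulli_seq lt_kn IHn.
Qed.

Lemma bernoulli0 : bernoulli 0 = 1.
Proof. by []. Qed.

Lemma bernoulli_rec n : (1 <= n)%N ->
  \sum_(0 <= k < n.+1) 'C(n.+1, k)%:R * bernoulli k = 0.
Proof.
case: n => // n _; rewrite big_nat_recr //= {2}/bernoulli /=.
rewrite nth_rcons size_bernoulli_seq ltnn eqxx binSn.
rewrite mulrC divfK ?pnatr_eq0 //; apply/eqP; rewrite subr_eq0; apply/eqP.
by rewrite !big_nat; apply: eq_bigr => k /= lt_kn; rewrite nth_bernoulli_seq.
Qed.

(* a = b (mod p ^ e) is only defined between rationals whose denominators are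
   coprime to p, so this side condition is part of the relation. *)
Definition rat_congr (p e : nat) (a b : rat) : Prop :=
  [/\ coprimez p (denq a), coprimez p (denq b)
    & ((p ^ e)%N %| numq (a - b))%Z].

Definition bernoulli_conv (m : nat) : rat :=
  \sum_(0 <= r < m.+1) 'C(m.+1, r)%:R * bernoulli r * bernoulli (m - r).

(* Main.v *)
(** Summation by parts gives, with [P j n = \sum_(k < n) k ^ j],
    [\sum_(k < p) k ^ m H_k = H_(p-1) P m p - \sum_(0 < i < p) P m i / i].
    The first term vanishes mod [p ^ 2] by Wolstenholme's theorem.  Expanding
    [P m i] by Faulhaber's formula turns the second one into a combination of
    power sums [P j p] with [j <= m], which are congruent to [p B_j] mod [p ^ 2];
    the isolated term [B_m] arises because the sum of [i ^ 0] over [0 < i < p]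
    is [p - 1] instead of [p]. *)
Require Import Defs.
From HB Require Import structures.
From mathcomp Require Import all_boot all_order all_algebra.
From mathcomp Require Import ring.
Import GRing.Theory Num.Theory.
Local Open Scope ring_scope.

(** * Faulhaber's formula and summation by parts *)

(** Both sides are the trinomial coefficient [n! / (r! j! (n - r - j)!)]. *)
Lemma mul_bin_bin n r j : (r + j <= n)%N ->
  ('C(n, r) * 'C(n - r, j) = 'C(n, j) * 'C(n - j, r))%N.
Proof.
move=> le_rj_n.
have le_rn := leq_trans (leq_addr j r) le_rj_n.
have le_jn := leq_trans (leq_addl r j) le_rj_n.
have le_jnr : (j <= n - r)%N by rewrite leq_subRL.
have le_rnj : (r <= n - j)%N by rewrite leq_subRL // addnC.
have pos : (0 < r`! * j`! * (n - (r + j))`!)%N by rewrite !muln_gt0 !fact_gt0.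
apply/eqP; rewrite -(eqn_pmul2r pos); apply/eqP; transitivity n`!.
  rewrite -(bin_fact le_rn) -(bin_fact le_jnr) subnDA; ring.
rewrite -(bin_fact le_jn) -(bin_fact le_rnj) [(r + j)%N]addnC subnDA; ring.
Qed.

(* The Bernoulli polynomial [B_(n.+1)(x)] without its constant term. *)
Definition bernoulli_sum (n : nat) (x : rat) : rat :=
  \sum_(r < n.+1) 'C(n.+1, r)%:R * bernoulli r * x ^+ (n.+1 - r).

Lemma bernoulli_sum0 n : bernoulli_sum n 0 = 0.
Proof.
by apply: big1 => r _; rewrite expr0n subn_eq0 leqNgt ltn_ord mulr0.
Qed.

(** For [j < n], trinomial symmetry pulls ['C(n.+1, j)] out of the coefficient of [x ^+ j] and
    leaves the Bernoulli recurrence of index [n - j], which vanishes. Only [j = n], [r = 0]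
    survives. *)
Lemma bernoulli_sum_step n x :
  bernoulli_sum n (x + 1) - bernoulli_sum n x = n.+1%:R * x ^+ n.
Proof.
rewrite /bernoulli_sum -sumrB.
(* The top term [j = n.+1 - r] of the binomial expansion cancels against [x ^+ (n.+1 - r)], hence
   the condition [r + j <= n]. *)
transitivity (\sum_(r < n.+1) \sum_(j < n.+1 | (r + j <= n)%N)
    ('C(n.+1, r) * 'C(n.+1 - r, j))%:R * bernoulli r * x ^+ j).
  apply: eq_bigr => r _.
  rewrite -mulrBr [x + 1]addrC exprDn big_ord_recr /= subnn expr1n mul1r binn mulr1n.
  rewrite addrK (big_ord_widen n.+1
    (fun j => 1 ^+ (n.+1 - r - j) * x ^+ j *+ 'C(n.+1 - r, j))) ?leq_subr //.
  rewrite big_distrr /=; apply: eq_big => j.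
    by rewrite ltn_subRL ltnS.
  by rewrite expr1n mul1r natrM -mulr_natr => _; ring.
rewrite (exchange_big_dep xpredT) //= big_ord_recr /= big1 ?add0r.
  rewrite (bigD1 ord0) //= big1 ?addr0 => [|r /andP[]].
    by rewrite bin0 mul1n subn0 binSn mulr1.
  by rewrite -[leqRHS]add0n leq_add2r leqn0 => /eqP r0 /eqP[]; apply: val_inj.
move=> j _.
transitivity ('C(n.+1, j)%:R * x ^+ j *
    \sum_(0 <= r < n.+1 - j) 'C(n.+1 - j, r)%:R * bernoulli r).
  rewrite big_mkord (big_ord_widen n.+1
    (fun r => 'C(n.+1 - j, r)%:R * bernoulli r)) ?leq_subr //.
  rewrite big_distrr /=; apply: eq_big => r.
    by rewrite ltn_subRL ltnS addnC.
  by move=> le_rj_n; rewrite mul_bin_bin ?natrM ?(leqW le_rj_n) //; ring.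
rewrite subSn ?(ltnW (ltn_ord j)) // bernoulli_rec ?mulr0 //.
by rewrite subn_gt0.
Qed.

Definition power_sum (m n : nat) : rat := \sum_(0 <= k < n) k%:R ^+ m.

Lemma faulhaber m n : power_sum m n = m.+1%:R^-1 * bernoulli_sum m n%:R.
Proof.
rewrite /power_sum (telescope_sumr_eq
  (fun k => m.+1%:R^-1 * bernoulli_sum m k%:R)) ?bernoulli_sum0 ?mulr0 ?subr0 //.
move=> k _.
by rewrite -mulrBr -[k.+1%:R]natr1 bernoulli_sum_step mulKf ?pnatr_eq0.
Qed.

(** The correction comes from [0 ^+ 0 = 1]. *)
Lemma power_sum_drop0 m n : (0 < n)%N ->
  \sum_(1 <= i < n) i%:R ^+ m = power_sum m n - (m == 0)%:R.
Proof.
by move=> n_gt0; rewrite /power_sum (big_ltn n_gt0) mulr0n expr0n addrC addKr.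
Qed.

(** The coefficient of [1 / i] is the sum of [f k] over [i <= k <= n], a difference of two sums
    starting at [0]; thus [f 0] cancels on the right. *)
Lemma sum_mul_harmonic (f : nat -> rat) n :
  \sum_(1 <= k < n.+1) f k * harmonic k =
    harmonic n * \sum_(0 <= k < n.+1) f k
    - \sum_(1 <= i < n.+1) (\sum_(0 <= k < i) f k) / i%:R.
Proof.
elim: n => [|n IHn].
  have -> : harmonic 0 = 0 by exact: big_geq.
  by rewrite mul0r !big_geq // subr0.
have harmonicS : harmonic n.+1 = harmonic n + n.+1%:R^-1.
  by rewrite /harmonic big_nat_recr.
rewrite big_nat_recr //= IHn [X in _ = _ - X]big_nat_recr //=.
rewrite [X in _ = _ * X - _]big_nat_recr //= harmonicS; ring.
Qed.

(** * Congruences as membership in a subring of the rationals *)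

(* The localization of the integers at [p], when [p] is prime. *)
Definition plocal (p : nat) : {pred rat} := fun x => coprimez p (denq x).

(** The reduced denominator divides any other one, so fractions need not be normalized to be shown
    [p]-integral. *)
Lemma plocalP (p : nat) (x : rat) :
  reflect (exists2 d : int, coprimez p d & exists n : int, x * d%:~R = n%:~R)
          (x \in plocal p).
Proof.
apply: (iffP idP) => [px | [d cop_pd [n xd]]].
  by exists (denq x) => //; exists (numq x); rewrite numqE.
have /eqP : (numq x * d)%:~R = (n * denq x)%:~R :> rat.
  by rewrite !intrM numqE -xd; ring.
rewrite eqr_int => /eqP eq_nd.
have /dvdzP[q def_d] : (denq x %| d)%Z.
  rewrite -(Gauss_dvdzr _ (n := numq x)) ?eq_nd ?dvdz_mull //.
  by rewrite coprimezE coprime_sym coprime_num_den.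
by move: cop_pd; rewrite def_d coprimezMr => /andP[].
Qed.

Lemma plocal_subring (p : nat) : subring_closed (plocal p).
Proof.
split=> [|x y|x y].
- by apply/plocalP; exists 1; rewrite ?coprimezE ?coprimen1 //; exists 1.
- move=> /plocalP[d pd [n xd]] /plocalP[e pe [k ye]]; apply/plocalP.
  exists (d * e); first by rewrite coprimezMr pd.
  by exists (n * e - k * d); rewrite intrB !intrM -xd -ye; ring.
move=> /plocalP[d pd [n xd]] /plocalP[e pe [k ye]]; apply/plocalP.
exists (d * e); first by rewrite coprimezMr pd.
by exists (n * k); rewrite !intrM -xd -ye; ring.
Qed.

HB.instance Definition _ p :=
  GRing.isSubringClosed.Build rat (plocal p) (plocal_subring p).

Lemma plocalV p n : coprime p n -> n%:R^-1 \in plocal p.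
Proof.
move=> cop_pn; apply/plocalP; exists n%:Z; first by rewrite coprimezE.
(* [coprime p 0] holds for [p = 1]; the inverse of [0] is then [0]. *)
case: (eqVneq n 0%N) => [->|n0]; first by exists 0; rewrite mulr0.
by exists 1; rewrite mulVf // pnatr_eq0.
Qed.

Lemma plocalV_lt p n : prime p -> (0 < n < p)%N -> n%:R^-1 \in plocal p.
Proof.
move=> p_pr /andP[n_gt0 lt_np]; apply: plocalV.
by rewrite prime_coprime // gtnNdvd.
Qed.

(** Clearing denominators leaves a factor [d] prime to [p], which Gauss's lemma cancels. *)
Lemma dvdz_numq_plocal (p e : nat) (x : rat) : (0 < p)%N -> x / p%:R ^+ e \in plocal p ->
  ((p ^ e)%N %| numq x)%Z.
Proof.
move=> p_gt0 /plocalP[d cop_pd [n xd]].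
have q_neq0 : (p ^ e)%N%:R != 0 :> rat by rewrite pnatr_eq0 -lt0n expn_gt0 p_gt0.
have /eqP : (numq x * d)%:~R = ((p ^ e)%N%:Z * (n * denq x))%:~R :> rat.
  rewrite !intrM numqE -xd -natrX /=; field.
  exact: q_neq0.
rewrite eqr_int => /eqP eq_nd.
rewrite -(Gauss_dvdzl _ (p := d)) ?eq_nd ?dvdz_mulr //.
by rewrite coprimezE /= coprimeXl.
Qed.

Lemma plocal_rat_congr (p e : nat) (a b : rat) : (0 < p)%N ->
  a \in plocal p -> b \in plocal p -> (a - b) / p%:R ^+ e \in plocal p ->
  rat_congr p e a b.
Proof. by move=> p_gt0 pa pb pab; split=> //; apply: dvdz_numq_plocal. Qed.

(** * Bernoulli numbers, power sums and Wolstenholme's theorem *)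

(** Solving the recurrence for [bernoulli n] divides only by [n.+1 < p]. This is the easy part of
    the von Staudt-Clausen theorem. *)
Lemma plocal_bernoulli p n : prime p -> (n < p - 1)%N ->
  bernoulli n \in plocal p.
Proof.
move=> p_pr; elim/ltn_ind: n => n IHn lt_np.
case: (posnP n) => [-> | n_gt0]; first by rewrite bernoulli0 rpred1.
have lt_n1p : (n.+1 < p)%N by rewrite ltn_subRL add1n in lt_np.
have := bernoulli_rec n_gt0; rewrite big_nat_recr //= binSn => /eqP.
rewrite addrC addr_eq0 => /eqP def_B.
rewrite -[bernoulli n](mulKf (_ : n.+1%:R != 0 :> rat)) ?pnatr_eq0 // def_B.
rewrite rpredM ?plocalV_lt // rpredN big_nat rpred_sum // => k /andP[_ lt_kn] /=.
by rewrite rpredM ?rpred_nat ?IHn // (ltn_trans lt_kn).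
Qed.

(** In Faulhaber's formula the term [r = m] is exactly [p B_m]; every other term carries [p] to a
    power at least 2, with a [p]-integral coefficient. *)
Lemma power_sum_congr p m : prime p -> (m < p - 1)%N ->
  (power_sum m p - p%:R * bernoulli m) / p%:R ^+ 2 \in plocal p.
Proof.
move=> p_pr lt_mp.
have p_neq0 : p%:R != 0 :> rat by rewrite pnatr_eq0 -lt0n prime_gt0.
have lt_m1p : (m.+1 < p)%N by rewrite ltn_subRL add1n in lt_mp.
rewrite faulhaber /bernoulli_sum big_ord_recr /= binSn subSnn expr1.
have m_neq0 : m.+1%:R != 0 :> rat by rewrite pnatr_eq0.
set s := \sum_(_ < _) _.
have -> : (m.+1%:R^-1 * (s + m.+1%:R * bernoulli m * p%:R)
   - p%:R * bernoulli m) / p%:R ^+ 2 = m.+1%:R^-1 * (s / p%:R ^+ 2).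
  by field; rewrite p_neq0 nat1r m_neq0.
rewrite rpredM ?plocalV_lt // mulr_suml rpred_sum // => r _.
have -> : (m.+1 - r = (m - r).-1.+2)%N.
  by rewrite subSn ?(ltnW (ltn_ord r)) // prednK // subn_gt0.
rewrite -addn2 exprD -mulrA mulfK ?expf_neq0 //.
rewrite !(rpredM, rpredX, rpred_nat) //.
by rewrite plocal_bernoulli // (ltn_trans _ lt_mp).
Qed.

Lemma fermat_plocal p i : prime p -> (i%:R - i%:R ^+ p) / p%:R \in plocal p.
Proof.
move=> p_pr; have p_neq0 : p%:R != 0 :> rat by rewrite pnatr_eq0 -lt0n prime_gt0.
have le_i : (i <= i ^ p)%N.
  by case: i => // i; rewrite -{1}[i.+1]expn1 leq_pexp2l // prime_gt0.
have /eqP := fermat_little i p_pr; rewrite eqn_mod_dvd // => /dvdnP[q def_q].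
have -> : i%:R - i%:R ^+ p = - (q * p)%:R :> rat.
  by rewrite -natrX -def_q natrB // opprB.
by rewrite natrM mulNr mulfK // rpredN rpred_nat.
Qed.

(** Pairing [i] with [p - i] yields one factor [p]. The remaining sum of [t i] is, modulo [p], minus
    a power sum of exponent [p - 3], which [power_sum_congr] shows divisible by [p]. *)
Lemma wolstenholme p : prime p -> (3 < p)%N ->
  harmonic p.-1 / p%:R ^+ 2 \in plocal p.
Proof.
move=> p_pr p_gt3.
have p_gt0 := prime_gt0 p_pr.
have p_neq0 : p%:R != 0 :> rat by rewrite pnatr_eq0 -lt0n.
pose t (i : nat) : rat := (i%:R * (p%:R - i%:R))^-1.
have def_H : harmonic p.-1 = 2%:R^-1 * (p%:R * \sum_(1 <= i < p) t i).
  have twice : 2%:R * harmonic p.-1 = p%:R * \sum_(1 <= i < p) t i.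
    rewrite mulr_natl mulr2n /harmonic prednK // {2}big_nat_rev /= -big_split /=.
    rewrite big_distrr /= !big_nat; apply: eq_bigr => i /andP[i_gt0 lt_ip].
    have i_neq0 : i%:R != 0 :> rat by rewrite pnatr_eq0 -lt0n.
    have pi_neq0 : p%:R - i%:R != 0 :> rat.
      by rewrite subr_eq0 eqr_nat neq_ltn lt_ip orbT.
    rewrite add1n subSS natrB ?(ltnW lt_ip) // /t; field.
    by rewrite i_neq0 pi_neq0.
  by rewrite -twice mulKf.
(* Fermat: [1 / (i (p - i)) = - 1 / i ^ 2 = - i ^ (p - 3)] modulo [p]. *)
have t_congr i : (1 <= i < p)%N -> (t i + i%:R ^+ (p - 3)) / p%:R \in plocal p.
  move=> /andP[i_gt0 lt_ip].
  have i_neq0 : i%:R != 0 :> rat by rewrite pnatr_eq0 -lt0n.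
  have pi_neq0 : p%:R - i%:R != 0 :> rat.
    by rewrite subr_eq0 eqr_nat neq_ltn lt_ip orbT.
  (* Over the common denominator [p - i], the numerator is a multiple of the Fermat quotient of [i]
     plus what the [p] in [p - i] contributes. *)
  have -> : (t i + i%:R ^+ (p - 3)) / p%:R =
      (i%:R^-1 ^+ 2 * ((i%:R - i%:R ^+ p) / p%:R) + i%:R ^+ (p - 3))
      / (p%:R - i%:R).
    have -> : i%:R ^+ p = i%:R ^+ 3 * i%:R ^+ (p - 3) :> rat.
      by rewrite -exprD subnKC // ltnW.
    by rewrite /t; field; rewrite i_neq0 pi_neq0 p_neq0.
  rewrite -natrB ?(ltnW lt_ip) //.
  have iV : i%:R^-1 \in plocal p by rewrite plocalV_lt // i_gt0.
  have piV : (p - i)%:R^-1 \in plocal p.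
    by rewrite plocalV_lt // subn_gt0 lt_ip ltn_subrL i_gt0.
  apply: rpredM => //; apply: rpredD; last by rewrite rpredX ?rpred_nat.
  by apply: rpredM; [rewrite rpredX | exact: fermat_plocal].
have p3_gt0 : (0 < p - 3)%N by rewrite subn_gt0.
have sum_congr : (\sum_(1 <= i < p) i%:R ^+ (p - 3)) / p%:R \in plocal p.
  have lt_p3 : (p - 3 < p - 1)%N by rewrite ltn_sub2l // ltnW // ltnW.
  rewrite power_sum_drop0 // eqn0Ngt p3_gt0 subr0.
  have -> : power_sum (p - 3) p / p%:R = p%:R *
     ((power_sum (p - 3) p - p%:R * bernoulli (p - 3)) / p%:R ^+ 2)
     + bernoulli (p - 3) by field.
  apply: rpredD; last exact: plocal_bernoulli.
  by apply: rpredM; [exact: rpred_nat | exact: power_sum_congr].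
have -> : harmonic p.-1 / p%:R ^+ 2 = 2%:R^-1 *
    (\sum_(1 <= i < p) (t i + i%:R ^+ (p - 3)) / p%:R
     - (\sum_(1 <= i < p) i%:R ^+ (p - 3)) / p%:R).
  by rewrite -mulr_suml big_split /= def_H; field.
rewrite rpredM ?plocalV_lt ?(ltn_trans _ p_gt3) // rpredB //.
by rewrite big_nat rpred_sum.
Qed.

Theorem theorem3p1 (p m : nat) (hp : prime p) (hp3 : (3 < p)%N)
    (hm0 : (0 < m)%N) (hmp : (m < p - 1)%N) :
  rat_congr p 2
    (\sum_(1 <= k < p) k%:R ^+ m * harmonic k)
    (bernoulli m - p%:R / m.+1%:R * bernoulli_conv m).
Proof.
have p_gt0 := prime_gt0 hp.
have lt_m1p : (m.+1 < p)%N by rewrite ltn_subRL add1n in hmp.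
have m_neq0 : m.+1%:R != 0 :> rat by rewrite pnatr_eq0.
have B_loc r : (r <= m)%N -> bernoulli r \in plocal p.
  by move=> le_rm; rewrite plocal_bernoulli // (leq_ltn_trans le_rm).
have V_loc : m.+1%:R^-1 \in plocal p by rewrite plocalV_lt.
apply: plocal_rat_congr => //.
- rewrite big_nat rpred_sum // => k /andP[_ lt_kp].
  apply: rpredM; first by rewrite rpredX ?rpred_nat.
  rewrite /harmonic big_nat rpred_sum // => i /andP[i_gt0 le_ik].
  by rewrite plocalV_lt // i_gt0 (leq_trans le_ik).
- apply: rpredB; first exact: B_loc.
  apply: rpredM; first by rewrite rpredM ?rpred_nat.
  rewrite /bernoulli_conv big_nat rpred_sum // => r /andP[_ le_rm].
  apply: rpredM; last by rewrite B_loc ?leq_subr.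
  by apply: rpredM; [exact: rpred_nat | exact: B_loc].
pose c r : rat := 'C(m.+1, r)%:R * bernoulli r.
(* Every exponent [m.+1 - r] in Faulhaber's formula is positive, so division by [i] just lowers it
   to [m - r]. *)
have sum_div : \sum_(1 <= i < p) power_sum m i / i%:R = m.+1%:R^-1 *
    \sum_(r < m.+1) c r * \sum_(1 <= i < p) i%:R ^+ (m - r).
  under [in RHS]eq_bigr do rewrite big_distrr /=.
  rewrite exchange_big /= big_distrr /= !big_nat; apply: eq_bigr => i.
  case/andP=> i_gt0 _; rewrite faulhaber /bernoulli_sum -mulrA; congr (_ * _).
  rewrite mulr_suml; apply: eq_bigr => r _.
  rewrite subSn ?leq_ord // exprSr -!mulrA divff ?mulr1 ?mulrA //.
  by rewrite pnatr_eq0 -lt0n.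
(* Only [r = m] has exponent [0]; its correction [c m] equals [m.+1 * B_m]. *)
have sum_drop0 : \sum_(r < m.+1) c r * \sum_(1 <= i < p) i%:R ^+ (m - r) =
    \sum_(r < m.+1) c r * power_sum (m - r) p - m.+1%:R * bernoulli m.
  under eq_bigr do rewrite power_sum_drop0 // mulrBr.
  rewrite sumrB; congr (_ - _); rewrite big_ord_recr /= subnn eqxx mulr1.
  rewrite /c binSn big1 ?add0r // => r _.
  by rewrite subn_eq0 leqNgt ltn_ord mulr0.
have def_conv : bernoulli_conv m = \sum_(r < m.+1) c r * bernoulli (m - r).
  by rewrite /bernoulli_conv big_mkord.
have sum_defect : \sum_(r < m.+1) c r *
      ((power_sum (m - r) p - p%:R * bernoulli (m - r)) / p%:R ^+ 2) =
    (\sum_(r < m.+1) c r * power_sum (m - r) p - p%:R * bernoulli_conv m)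
    / p%:R ^+ 2.
  rewrite def_conv big_distrr /= -sumrB mulr_suml.
  by apply: eq_bigr => r _; ring.
(* An exact identity: [B_m] cancels, and what remains is built from the quotients by [p ^ 2] of
   [wolstenholme] and [power_sum_congr]. *)
have -> : (\sum_(1 <= k < p) k%:R ^+ m * harmonic k
     - (bernoulli m - p%:R / m.+1%:R * bernoulli_conv m)) / p%:R ^+ 2 =
  harmonic p.-1 / p%:R ^+ 2 * power_sum m p - m.+1%:R^-1 *
    \sum_(r < m.+1) c r *
      ((power_sum (m - r) p - p%:R * bernoulli (m - r)) / p%:R ^+ 2).
  rewrite sum_defect.
  rewrite -{1}(prednK p_gt0) sum_mul_harmonic (prednK p_gt0).
  rewrite -/(power_sum m p) [X in _ - X - _]sum_div sum_drop0.
  by field; rewrite nat1r m_neq0 pnatr_eq0 -lt0n p_gt0.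
apply: rpredB.
  apply: rpredM; first exact: wolstenholme.
  by apply: rpred_sum => k _; rewrite rpredX ?rpred_nat.
apply: rpredM => //; apply: rpred_sum => r _; apply: rpredM.
  by apply: rpredM; [exact: rpred_nat | apply: B_loc; exact: leq_ord].
by rewrite power_sum_congr // (leq_ltn_trans (leq_subr _ _)).
Qed.
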